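(* Let $\mathcal{F}=(W,\preccurlyeq,V_{\mathcal{F}})$ be a finite poset model. For all $w_1,w_2\in W$: $w_1\equiv_\eta w_2$ in $\mathcal{F}$ if and only if the states $[w_1]_{\rightleftharpoons}$ and $[w_2]_{\rightleftharpoons}$ are strongly bisimilar in the LTS $\mathcal{L}_A(\mathcal{F})$.
   Context: $\mathcal{F}$: finite partial order $(W,\preccurlyeq)$ with valuation $V_{\mathcal{F}}:PL\to2^W$; write $V^{-1}(w)=\{p: w\in V_{\mathcal{F}}(p)\}$, and $w\leftrightarrow w'$ for ''$w\preccurlyeq w'$ or $w'\preccurlyeq w$''. An undirected path of length $\ell$ is $\pi:\{0,\dots,\ell\}\to W$ with $\pi(i)\leftrightarrow\pi(i+1)$ for all $i<\ell$; a $\pm$-path is one with $\ell\ge2$, $\pi(0)\preccurlyeq\pi(1)$ and $\pi(\ell)\preccurlyeq\pi(\ell-1)$. $\mathrm{SLCS}_\eta$: $\Phi::=p\mid\neg\Phi\mid\Phi_1\wedge\Phi_2\mid\eta(\Phi_1,\Phi_2)$ with $w\models\eta(\Phi_1,\Phi_2)$ iff some $\pm$-path $\pi$ of length $\ell$ with $\pi(0)=w$ has $\pi(\ell)\models\Phi_2$ and $\pi(i)\models\Phi_1$ for $i<\ell$ (atoms and Boolean connectives standard); $w_1\equiv_\eta w_2$ iff they satisfy the same formulas. Relation $w_1\rightleftharpoons w_2$ holds iff there is an undirected path from $w_1$ to $w_2$ all of whose elements have the same set $V^{-1}(\cdot)$; it is an equivalence relation with classes $[w]_{\rightleftharpoons}$.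 The LTS $\mathcal{L}_A(\mathcal{F})$ has states $W/{\rightleftharpoons}$, labels $2^{PL}\cup\{\mathbf{s},\mathbf{d}\}$ ($\mathbf{s},\mathbf{d}\notin PL$), and is the smallest transition relation with: $[w]\xrightarrow{V^{-1}(w)}[w]$ for every $w$; $[w]\xrightarrow{\mathbf{s}}[w']$ whenever $w\leftrightarrow w'$; $[w]\xrightarrow{\mathbf{d}}[w']$ whenever $w'\preccurlyeq w$. A strong bisimulation on an LTS is a relation $B$ such that if $B(s_1,s_2)$ and $s_1\xrightarrow{\lambda}s_1'$ then $s_2\xrightarrow{\lambda}s_2'$ with $B(s_1',s_2')$, and symmetrically; strongly bisimilar means related by some strong bisimulation. *)

(* Defs.v *)
From HB Require Import structures.
From mathcomp Require Import all_boot all_order.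
From mathcomp Require Import generic_quotient boolp classical_sets.

Set Implicit Arguments.
Unset Strict Implicit.
Unset Printing Implicit Defensive.

Import Order.Theory.
Local Open Scope order_scope.
Local Open Scope quotient_scope.

Section Paths.
Context {d : Order.disp_t} {W : finPOrderType d}.

(* A path of length l is pi : nat -> W of which only pi 0, ..., pi l matter. *)
Definition undirected_path (pi : nat -> W) (l : nat) : Prop :=
  forall i : nat, (i < l)%N -> pi i >=< pi i.+1.

Definition pm_path (pi : nat -> W) (l : nat) : Prop :=
  [/\ undirected_path pi l, (2 <= l)%N, pi 0%N <= pi 1%N & pi l <= pi l.-1].

End Paths.

Inductive form (PL : Type) : Type :=
| Atom of PL
| Neg of form PL
| And of form PL & form PL
| Eta of form PL & form PL.

Section Logic.
Context {PL : Type} {d : Order.disp_t} {W : finPOrderType d}.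
Variable V : PL -> {set W}.

Fixpoint sat (w : W) (phi : form PL) {struct phi} : Prop :=
  match phi with
  | Atom p => w \in V p
  | Neg phi1 => ~ sat w phi1
  | And phi1 phi2 => sat w phi1 /\ sat w phi2
  | Eta phi1 phi2 =>
      exists (pi : nat -> W) (l : nat),
        [/\ pm_path pi l, pi 0%N = w, sat (pi l) phi2 &
            forall i : nat, (i < l)%N -> sat (pi i) phi1]
  end.

Definition eta_equiv (w1 w2 : W) : Prop :=
  forall phi : form PL, sat w1 phi <-> sat w2 phi.

(* The set V^{-1}(w) of the proposition letters that hold at w. *)
Definition Vinv (w : W) : set PL := [set p | w \in V p]%classic.

(* Boolean, through classical logic, as quotients require. *)
Definition vconn (w1 w2 : W) : bool :=
  `[< exists (pi : nat -> W) (l : nat),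
        [/\ undirected_path pi l, pi 0%N = w1, pi l = w2 &
            forall i j : nat, (i <= l)%N -> (j <= l)%N ->
              Vinv (pi i) = Vinv (pi j)] >].

Lemma vconn_refl : reflexive vconn.
Proof.
by move=> w; apply/asboolP; exists (fun=> w), 0%N; split.
Qed.

Lemma vconn_sym : symmetric vconn.
Proof.
suff imp x y : vconn x y -> vconn y x by move=> x y; apply/idP/idP; apply: imp.
move=> /asboolP[pi [l [pathP pi0 pil Veq]]]; apply/asboolP.
exists (fun i => pi (l - i)%N), l; split.
- move=> i il; rewrite comparable_sym -(subnSK il).
  by apply: pathP; rewrite subnSK ?leq_subr.
- by rewrite subn0.
- by rewrite subnn.
- by move=> i j _ _; apply: Veq; apply: leq_subr.
Qed.

Lemma vconn_trans : transitive vconn.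
Proof.
move=> y x z /asboolP[p [l [pP p0 pl pV]]] /asboolP[q [m [qP q0 qm qV]]].
apply/asboolP; exists (fun i => if (i <= l)%N then p i else q (i - l)%N), (l + m)%N.
split.
- move=> i ilm; case: (ltngtP i l) => [il|li|il].
  + exact: pP.
  + by rewrite subSn ?(ltnW li)//; apply: qP; rewrite ltn_subLR ?(ltnW li).
  + rewrite il subSnn pl -q0; apply: qP; by rewrite -(ltn_add2l l) addn0 -{1}il.
- by rewrite leq0n.
- case: leqP => [|_]; last by rewrite addKn.
  by rewrite -{2}(addn0 l) leq_add2l leqn0 => /eqP m0; rewrite -qm m0 addn0 q0.
- have key i : (i <= l + m)%N ->
    Vinv (if (i <= l)%N then p i else q (i - l)%N) = Vinv y.
    move=> ilm; case: leqP => li; first by rewrite -pl; apply: pV.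
    by rewrite -q0; apply: qV => //; rewrite leq_subLR.
  by move=> i j il jl; rewrite !key.
Qed.

Canonical vconn_equiv : equiv_rel W :=
  EquivRel vconn vconn_refl vconn_sym vconn_trans.

Definition state : Type := {eq_quot vconn_equiv}.

Definition class (w : W) : state := \pi_{eq_quot vconn_equiv} w.

Inductive label : Type :=
| LSet of set PL
| LS
| LD.

Inductive trans_A : state -> label -> state -> Prop :=
| trans_val (w : W) : trans_A (class w) (LSet (Vinv w)) (class w)
| trans_s (w w' : W) : w >=< w' -> trans_A (class w) LS (class w')
| trans_d (w w' : W) : w' <= w -> trans_A (class w) LD (class w').

End Logic.

Arguments trans_A {PL d W} V _ _ _.

Section Bisimulation.
Context {S L : Type}.
Variable trans : S -> L -> S -> Prop.

Definition strong_bisimulation (B : S -> S -> Prop) : Prop :=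
  forall s1 s2 : S, B s1 s2 ->
    (forall (a : L) (s1' : S), trans s1 a s1' ->
       exists2 s2', trans s2 a s2' & B s1' s2') /\
    (forall (a : L) (s2' : S), trans s2 a s2' ->
       exists2 s1', trans s1 a s1' & B s1' s2').

Definition strongly_bisimilar (s1 s2 : S) : Prop :=
  exists2 B : S -> S -> Prop, strong_bisimulation B & B s1 s2.

End Bisimulation.

(* Main.v *)
Require Import Defs.
From mathcomp Require Import all_boot all_order.
From mathcomp Require Import generic_quotient boolp classical_sets.

(** Since [w <= w], the first step of a pm-path may stutter, so [Eta f g] holds
    at [w] iff some [v <= u] satisfies [g], where [u] is reachable from [w]
    through comparable [f]-points.  Bisimilar states therefore satisfy the same
    formulas: [s]-steps transport the [f]-path and a [d]-step its last edge, the
    gaps between representatives of one class being filled by paths inside that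
    class.  Conversely, as [W] is finite, each point [w] has a characteristic
    formula [chi w]; a [d]-step from [w] to [w'] is transported by
    [Eta (chi w) (chi w')], and an [s]-step by
    [Eta (chi w \/ chi w') (chi w')], for a path inside [chi w] does not leave
    the class of its starting point. *)

Set Implicit Arguments.
Unset Strict Implicit.
Unset Printing Implicit Defensive.

Import Order.Theory.
Local Open Scope order_scope.

(** * Paths through comparable points satisfying a predicate *)

Section Reachability.
Context {d : Order.disp_t} {W : finPOrderType d}.
Implicit Types (P Q : W -> Prop) (x y z u v : W).

(** Inductive counterpart of indexed paths, so that proofs go by induction on the path; [P] is
    required at both ends too. *)
Inductive reach P : W -> W -> Prop :=
| reach_refl x : P x -> reach P x x
| reach_step x y z : P x -> x >=< y -> reach P y z -> reach P x z.

Lemma reach_first P x y : reach P x y -> P x.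
Proof. by case. Qed.

Lemma reach_last P x y : reach P x y -> P y.
Proof. by elim. Qed.

Lemma reach_trans P y x z : reach P x y -> reach P y z -> reach P x z.
Proof.
by elim=> // {}x {}y z' Px xy _ IH /IH; apply: reach_step.
Qed.

Lemma reach_mono P Q x y :
  (forall u, P u -> Q u) -> reach P x y -> reach Q x y.
Proof.
move=> PQ; elim=> {x y} [x /PQ|x y z /PQ Qx xy _]; first exact: reach_refl.
exact: reach_step.
Qed.

Lemma reachP P x y :
  reach P x y <-> exists (pi : nat -> W) (l : nat),
    [/\ undirected_path pi l, pi 0%N = x, pi l = y &
        forall i : nat, (i <= l)%N -> P (pi i)].
Proof.
split=> [|[pi [l []]]].
  elim=> {x y} [x Px|x y z Px xy _ [pi [l [path_pi pi0 pil piP]]]].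
    by exists (fun=> x), 0%N.
  exists (fun i => if i is j.+1 then pi j else x), l.+1; split=> //.
  - by case=> [|i] il /=; [rewrite pi0 | apply: path_pi].
  - by case=> [|i] il //; apply: piP.
elim: l pi x => [|l IH] pi x path_pi pi0 pil piP.
  by rewrite -pil -pi0; apply/reach_refl/piP.
apply: (reach_step (y := pi 1%N)); rewrite -?pi0; first exact: piP.
- exact: path_pi.
- apply: (IH (fun i => pi i.+1)) => // i il; [exact: path_pi|exact: piP].
Qed.

(** Follow the path while [P] holds: the next point satisfies [Q]. If [P] never fails, the endpoint
    satisfies both and [u = v] serves. *)
Lemma reach_exit P Q x y : reach (fun u => P u \/ Q u) x y -> P x -> Q y ->
  exists u v, [/\ reach P x u, u >=< v & Q v].
Proof.
elim=> {x y} [x _ Px Qx|x y z _ xy yz IH Px Qz].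
  by exists x, x; split; rewrite ?comparablexx //; apply: reach_refl.
have [Py|Qy] := reach_first yz.
  have [u [v [yu uv Qv]]] := IH Py Qz.
  by exists u, v; split=> //; apply: reach_step yu.
by exists x, y; split=> //; apply: reach_refl.
Qed.

End Reachability.

Section StrongBisimilarity.
Context {S L : Type} (trans : S -> L -> S -> Prop).

Lemma strongly_bisimilar_refl s : strongly_bisimilar trans s s.
Proof.
exists eq => // s1 _ <-; split=> a s' s1s'; by exists s'.
Qed.

Lemma strongly_bisimilar_sym s t :
  strongly_bisimilar trans s t -> strongly_bisimilar trans t s.
Proof.
case=> B bisB Bst; exists (fun x y => B y x) => // x y /bisB[fw bw].
by split=> a x'; [apply: bw|apply: fw].
Qed.

Lemma strongly_bisimilar_step s t a s' :
  strongly_bisimilar trans s t -> trans s a s' ->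
  exists2 t', trans t a t' & strongly_bisimilar trans s' t'.
Proof.
case=> B bisB Bst ss'; have [fw _] := bisB _ _ Bst.
by have [t' tt' Bt'] := fw _ _ ss'; exists t' => //; exists B.
Qed.

End StrongBisimilarity.

Section Correspondence.
Context {PL : Type} {d : Order.disp_t} {W : finPOrderType d}.
Variable V : PL -> {set W}.
Implicit Types (f g : form PL) (w x y u v : W).

Lemma sat_EtaP w f g :
  sat V w (Eta f g) <->
  exists u v, [/\ reach (fun x => sat V x f) w u, v <= u & sat V v g].
Proof.
split=> [[pi [[|l] [[path_pi l2 _ last_pi] pi0 satg satf]]]|] //.
  exists (pi l), (pi l.+1); split=> //.
  by apply/reachP; exists pi, l; split=> // i il; apply: path_pi; apply: ltnW.
case=> u [v [/reachP[pi [l [path_pi pi0 pil satf]]] vu satg]].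
(* [rho] is [pi] with [w] prepended and [v] appended, so its length is at least 2 even when
   [l = 0]. *)
pose rho i := if i is j.+1 then if (j <= l)%N then pi j else v else w.
have rhol : rho l.+2 = v by rewrite /rho ltnn.
exists rho, l.+2; split=> //; last 2 first.
- by rewrite rhol.
- case=> [_|i]; first by rewrite /= -pi0; apply: satf.
  by rewrite !ltnS /rho => il; rewrite il; apply: satf.
split=> //; last by rewrite rhol /= leqnn pil.
- case=> [_|i]; first by rewrite /= pi0 comparablexx.
  rewrite !ltnS leq_eqVlt => /predU1P[->|il].
    by rewrite rhol /= leqnn pil ge_comparable.
  by rewrite /= il (ltnW il); apply: path_pi.
- by rewrite /= pi0.
Qed.

Lemma classP x y : class V x = class V y <-> vconn V x y.
Proof. by split=> [/eqquotP|xy]; last exact/eqquotP. Qed.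

Lemma reach_class P x y : (forall u, P u -> Vinv V u = Vinv V x) ->
  reach P x y -> class V x = class V y.
Proof.
move=> PV /reachP[pi [l [path_pi pi0 pil piP]]].
apply/classP/asboolP; exists pi, l; split=> // i j il jl.
by rewrite !PV //; apply: piP.
Qed.

Lemma class_Vinv x y : class V x = class V y -> Vinv V x = Vinv V y.
Proof. by move=> /classP/asboolP[pi [l [_ <- <-]]]; apply. Qed.

(** Each prefix of a path witnessing [vconn] is again a witness, so the path stays in the class. *)
Lemma class_reach x y : class V x = class V y ->
  reach (fun u => class V u = class V x) x y.
Proof.
move=> /classP/asboolP[pi [l [path_pi pi0 pil Veq]]].
apply/reachP; exists pi, l; split=> // i il.
apply/esym/classP/asboolP; exists pi, i; split=> //.
  by move=> j ji; apply: path_pi; apply: leq_trans il.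
by move=> j k ji ki; apply: Veq; apply: leq_trans il.
Qed.

Lemma trans_A_inv s a t : trans_A V s a t ->
  exists x y, [/\ s = class V x, t = class V y &
    match a with
    | LSet A => x = y /\ A = Vinv V x
    | LS => x >=< y
    | LD => y <= x
    end].
Proof. by case=> [w|x y xy|x y yx]; [exists w, w|exists x, y|exists x, y]. Qed.

(** * From bisimilarity to logical equivalence *)

Local Notation "s ~ t" := (strongly_bisimilar (trans_A V) s t)
  (at level 70, no associativity).

Lemma bisimilar_reach P w1 w2 u1 :
  (forall x y, class V x ~ class V y -> P x -> P y) ->
  class V w1 ~ class V w2 -> reach P w1 u1 ->
  exists2 u2, reach P w2 u2 & class V u1 ~ class V u2.
Proof.
move=> invP w12 w1u1; elim: w1u1 w2 w12 => {w1 u1}.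
  by move=> x Px y xy; exists y => //; apply/reach_refl/(invP x).
move=> x y z Px xy _ IH w2 xw2.
have [t w2t yt] := strongly_bisimilar_step xw2 (trans_s V xy).
have [a [b [w2a tb ab]]] := trans_A_inv w2t.
rewrite {}tb in yt; have [u2 bu2 zu2] := IH b yt.
(* The step may start at another representative [a] of the class of [w2]; a path inside the class
   bridges the gap. *)
have w2a_reach : reach P w2 a.
  apply: reach_mono (class_reach w2a) => u uw2; apply: (invP x) => //.
  by rewrite uw2.
exists u2 => //; apply: reach_trans w2a_reach _.
by apply: reach_step ab bu2; apply: (invP x) => //; rewrite -w2a.
Qed.

Lemma bisimilar_sat f w1 w2 :
  class V w1 ~ class V w2 -> sat V w1 f <-> sat V w2 f.
Proof.
suff imp x y : class V x ~ class V y -> sat V x f -> sat V y f.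
  by move=> w12; split; apply: imp => //; apply: strongly_bisimilar_sym.
elim: f x y => [p|f IH|f IHf g IHg|f IHf g IHg] x y xy.
(* The self-loop labelled by the valuation of [x] must be matched at the class of [y], which forces
   equal valuations. *)
- have [t yt _] := strongly_bisimilar_step xy (trans_val V x).
  have [a [b [ya _ [_ Vxa]]]] := trans_A_inv yt.
  have Vxy : Vinv V x = Vinv V y by rewrite Vxa (class_Vinv ya).
  by have /(congr1 (fun A => A p)) := Vxy; rewrite /Vinv /= => ->.
- by move=> /= nxf yf; apply/nxf/(IH y) => //; apply: strongly_bisimilar_sym.
- by case=> /= xf xg; split; [apply: IHf xf|apply: IHg xg].
- move=> /sat_EtaP[u [v [xu vu vg]]]; apply/sat_EtaP.
  have [u2 yu2 uu2] := bisimilar_reach IHf xy xu.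
  have [t u2t vt] := strongly_bisimilar_step uu2 (trans_d V vu).
  have [a [b [u2a tb ba]]] := trans_A_inv u2t.
  rewrite {}tb in vt; have satu2 := reach_last yu2.
  exists a, b; split=> //; last exact: IHg vg.
  apply: reach_trans yu2 _; apply: reach_mono (class_reach u2a) => z zu2.
  apply: IHf satu2; rewrite zu2.
  exact: strongly_bisimilar_refl.
Qed.

(** * From logical equivalence to bisimilarity *)

Lemma class_eta_equiv x y : class V x = class V y -> eta_equiv V x y.
Proof.
by move=> xy f; apply: bisimilar_sat; rewrite xy; apply: strongly_bisimilar_refl.
Qed.

Lemma eta_equiv_sym x y : eta_equiv V x y -> eta_equiv V y x.
Proof. by move=> xy f; rewrite xy. Qed.

Lemma eta_equiv_trans y x z :
  eta_equiv V x y -> eta_equiv V y z -> eta_equiv V x z.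
Proof. by move=> xy yz f; rewrite xy yz. Qed.

Lemma eta_equiv_Vinv x y : eta_equiv V x y -> Vinv V x = Vinv V y.
Proof. by move=> xy; apply/funext => p; apply/propext/(xy (Atom p)). Qed.

Lemma separating_formula x y : ~ eta_equiv V x y ->
  exists f, sat V x f /\ ~ sat V y f.
Proof.
move=> /existsNP[f nxy]; have [xf|nxf] := pselect (sat V x f).
  by exists f; split=> // yf; apply: nxy.
by exists (Neg f); split=> //= nyf; apply: nxy; split=> // yf; case: nyf.
Qed.

(* A formula [f0] must be supplied: there are none when [PL] is empty. *)
Lemma characteristic_formula (f0 : form PL) w :
  exists f, forall u, sat V u f <-> eta_equiv V w u.
Proof.
suff [f [wf fw]] : exists f, sat V w f /\
    forall u, u \in enum W -> sat V u f -> eta_equiv V w u.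
  exists f => u; split=> [|wu]; first by apply: fw; rewrite mem_enum.
  exact/wu.
elim: (enum W) => [|u s [f [wf fs]]].
  (* A tautology, serving as the empty conjunction of separating formulas. *)
  by exists (Neg (And f0 (Neg f0))); split=> //= -[].
have [wu|/separating_formula[g [wg nug]]] := pselect (eta_equiv V w u).
  by exists f; split=> // v; rewrite inE => /predU1P[->|/fs].
exists (And f g); split=> // v; rewrite inE => /predU1P[-> [_ /nug]//|vs [vf _]].
exact: fs vf.
Qed.

Lemma sat_or w f g :
  sat V w (Neg (And (Neg f) (Neg g))) <-> sat V w f \/ sat V w g.
Proof.
split=> /= [/not_andP[] /contrapT|[wf|wg] []//]; [by left|by right].
Qed.

(** Atoms are formulas, so the valuation is constant along the path. *)
Lemma eta_equiv_reach_class x y :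
  reach (eta_equiv V x) x y -> class V x = class V y.
Proof. by apply: reach_class => u /eta_equiv_Vinv. Qed.

Lemma eta_equiv_down x x' y : eta_equiv V x y -> x' <= x ->
  exists u v, [/\ class V y = class V u, v <= u & eta_equiv V x' v].
Proof.
(* Without formulas all points are equivalent, and [y] itself serves twice. *)
move=> xy x'x; have [[f0 _]|nform] := pselect (exists f : form PL, True); last first.
  by exists y, y; split=> // f; case: nform; exists f.
have [f fP] := characteristic_formula f0 x.
have [g gP] := characteristic_formula f0 x'.
have /xy/sat_EtaP[u [v [yu vu /gP x'v]]] : sat V x (Eta f g).
  apply/sat_EtaP; exists x, x'; split=> //; last exact/gP.
  by apply/reach_refl/fP.
exists u, v; split=> //; apply: eta_equiv_reach_class.
by apply: reach_mono yu => z /fP; apply/eta_equiv_trans/eta_equiv_sym.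
Qed.

Lemma eta_equiv_comparable x x' y : eta_equiv V x y -> x >=< x' ->
  exists u v, [/\ class V y = class V u, u >=< v & eta_equiv V x' v].
Proof.
move=> xy xx'; have [[f0 _]|nform] := pselect (exists f : form PL, True); last first.
  by exists y, y; rewrite comparablexx; split=> // f; case: nform; exists f.
have [f fP] := characteristic_formula f0 x.
have [g gP] := characteristic_formula f0 x'.
have /xy/sat_EtaP[z [v [yz vz /gP x'v]]] :
    sat V x (Eta (Neg (And (Neg f) (Neg g))) g).
  (* The path goes from [x] to [x'], and its last edge stutters at [x']. *)
  apply/sat_EtaP; exists x', x'; split=> //; last exact/gP.
  apply: (reach_step _ xx'); first by apply/sat_or; left; apply/fP.
  by apply/reach_refl/sat_or; right; apply/gP.
have orP t : sat V t (Neg (And (Neg f) (Neg g))) ->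
    eta_equiv V y t \/ eta_equiv V x' t.
  case/sat_or=> [/fP xt|/gP]; last by right.
  by left; apply: eta_equiv_trans xt; apply: eta_equiv_sym.
have yv : reach (fun t => eta_equiv V y t \/ eta_equiv V x' t) y v.
  apply: reach_trans (reach_mono orP yz) _.
  apply: reach_step (orP _ (reach_last yz)) (ge_comparable vz) _.
  by apply: reach_refl; right.
(* The part before the exit edge consists of points equivalent to [y], so it stays in the class of
   [y]. *)
have [u [t [yu ut x't]]] := reach_exit yv (fun=> iff_refl _) x'v.
by exists u, t; split=> //; apply: eta_equiv_reach_class.
Qed.

Lemma eta_equiv_step x y a t : eta_equiv V x y -> trans_A V (class V x) a t ->
  exists2 y', trans_A V (class V y) a (class V y') &
    exists2 x', t = class V x' & eta_equiv V x' y'.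
Proof.
move=> xy /trans_A_inv[u [u' [xu -> uu']]].
have {xy}uy : eta_equiv V u y.
  by apply: eta_equiv_trans xy; apply/eta_equiv_sym/class_eta_equiv.
case: a uu' => [A [<- ->]|uu'|u'u].
- by exists y; [rewrite (eta_equiv_Vinv uy); apply: trans_val|exists u].
- have [v [v' [-> vv' u'v']]] := eta_equiv_comparable uy uu'.
  by exists v'; [apply: trans_s|exists u'].
- have [v [v' [-> v'v u'v']]] := eta_equiv_down uy u'u.
  by exists v'; [apply: trans_d|exists u'].
Qed.

Lemma eta_equiv_bisimilar x y : eta_equiv V x y -> class V x ~ class V y.
Proof.
(* Equivalence is lifted to states through some choice of representatives. *)
move=> xy; exists (fun s t => exists u v,
  [/\ s = class V u, t = class V v & eta_equiv V u v]); last by exists x, y.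
move=> _ _ [u [v [-> -> uv]]]; split=> a s' ss'.
  have [v' vv' [u' -> u'v']] := eta_equiv_step uv ss'.
  by exists (class V v') => //; exists u', v'.
have [u' uu' [v' -> v'u']] := eta_equiv_step (eta_equiv_sym uv) ss'.
by exists (class V u') => //; exists u', v'; split=> //; apply: eta_equiv_sym.
Qed.

End Correspondence.

Theorem theorem5p6 (PL : Type) (d : Order.disp_t) (W : finPOrderType d)
    (V : PL -> {set W}) (w1 w2 : W) :
  eta_equiv V w1 w2 <->
  strongly_bisimilar (trans_A V) (class V w1) (class V w2).
Proof.
by split=> [|w12 f]; [apply: eta_equiv_bisimilar|apply: bisimilar_sat].
Qed.
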